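(* Let $X=\{x_1,\dots,x_M\}\subset\mathbb{R}^d$, let $\mu,\nu\in\Delta_M$ be weights of probability measures $\sum_i\mu_i\delta_{x_i}$, $\sum_j\nu_j\delta_{x_j}$ with $\mu_i>0$ for all $i$, and let $c\colon\mathbb{R}^d\times\mathbb{R}^d\to\mathbb{R}$ be convex in the second argument. Let $U\supset\operatorname{conv}(X)$ be an open set. For $n\in\mathbb{N}$ let $Y_n=\{y^n_1,\dots,y^n_{N(n)}\}\subset\mathbb{R}^d$ be finite sets such that $U\subset\operatorname{conv}(Y_n)$ for all $n\in\mathbb{N}$ and $\operatorname{dist}(U,Y_n)\to0$ as $n\to\infty$, where $\operatorname{dist}(A,B)=\sup_{a\in A}\inf_{b\in B}\|a-b\|$. For each $n$ let $(\hat\pi^{x,n},\hat\pi^{y,n})$ be an optimal solution of the relaxed problem $(R_{Y_n})$ (defined in the context), with corresponding means $$\hat m_i^n=\frac1{\mu_i}\sum_{j=1}^M\hat\pi^{x,n}_{ij}x_j=\frac1{\mu_i}\sum_{k=1}^{N(n)}\hat\pi^{y,n}_{ik}y^n_k,\qquad i=1,\dots,M.$$ Then $$\lim_{n\to\infty}\sum_{i=1}^M\mu_i\,c(x_i,\hat m_i^n)=\lim_{n\to\infty}\sum_{i=1}^M\sum_{k=1}^{N(n)}\hat\pi^{y,n}_{ik}\,c(x_i,y^n_k)=V(\mu,\nu),$$ where $V(\mu,\nu)$ is the barycentric weak optimal transport cost (defined in the context). Furthermore, if $c$ is strictly convex in the second argument, then the optimal means $\hat m_i=\frac1{\mu_i}\sum_{j=1}^M\hat\pi_{ij}x_j$,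 $i=1,\dots,M$, in the problem defining $V(\mu,\nu)$ are unique (i.e. the same for every minimizer $\hat\pi$), and $$\lim_{n\to\infty}\hat m_i^n=\hat m_i\qquad\text{for } i=1,\dots,M.$$
   Context: Notation. $\Delta_M=\{x\in\mathbb{R}^M:x\ge0,\ \sum_jx_j=1\}$; $\|\cdot\|$ is the Euclidean norm; $\operatorname{conv}$ is the convex hull. $\Pi(\mu,\nu)=\{\pi\in\mathbb{R}^{M\times M}:\pi\ge0,\ \sum_j\pi_{ij}=\mu_i\ \forall i,\ \sum_i\pi_{ij}=\nu_j\ \forall j\}$. Barycentric weak optimal transport cost: $$V(\mu,\nu)=\min_{\pi\in\Pi(\mu,\nu)}\sum_{i=1}^M\mu_i\,c\Big(x_i,\frac1{\mu_i}\sum_{j=1}^M\pi_{ij}x_j\Big).$$ Relaxed problem $(R_Y)$ for a finite set $Y=\{y_1,\dots,y_N\}\subset\mathbb{R}^d$ with $X\subset\operatorname{conv}(Y)$: $$\min_{\pi^x\in\mathbb{R}^{M\times M},\ \pi^y\in\mathbb{R}^{M\times N}}\ \sum_{i=1}^M\sum_{k=1}^N\pi^y_{ik}\,c(x_i,y_k)$$ subject to $\pi^x,\pi^y\ge0$; $\sum_{j=1}^M\pi^x_{ij}=\sum_{k=1}^N\pi^y_{ik}=\mu_i$ for all $i$; $\sum_{i=1}^M\pi^x_{ij}=\nu_j$ for all $j$; and $\sum_{j=1}^M\pi^x_{ij}x_j=\sum_{k=1}^N\pi^y_{ik}y_k$ for all $i$. *)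

(* Defs.v *)
From HB Require Import structures.
From mathcomp Require Import all_boot all_order all_algebra.
From mathcomp Require Import all_classical all_reals all_analysis.
Import Order.TTheory GRing.Theory Num.Theory.
Import numFieldNormedType.Exports.

Set Implicit Arguments.
Unset Strict Implicit.
Unset Printing Implicit Defensive.

Local Open Scope classical_set_scope.
Local Open Scope ring_scope.

(* The norm `|v| that the library puts on 'rV[R]_d is the sup norm. *)
Definition eucl_norm (R : realType) (d : nat) (v : 'rV[R]_d) : R :=
  Num.sqrt (\sum_(k < d) v ord0 k ^+ 2).

(* Extended-real valued, so that no boundedness or nonemptiness convention
   enters. *)
Definition excess_dist (R : realType) (d : nat) (A B : set 'rV[R]_d) : \bar R :=
  ereal_sup [set ereal_inf [set (eucl_norm (a - b))%:E | b in B] | a in A].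

Definition convex_hull (R : realType) (d : nat) (A : set 'rV[R]_d) :
    set 'rV[R]_d :=
  smallest (@convex_set R 'rV[R]_d) A.

Definition strictly_convex_function (R : realType) (d : nat)
    (f : 'rV[R]_d -> R) : Prop :=
  forall (u v : 'rV[R]_d) (t : R), u != v -> 0 < t -> t < 1 ->
    f (t *: u + (1 - t) *: v) < t * f u + (1 - t) * f v.

Definition simplex (R : realType) (M : nat) : set 'rV[R]_M :=
  [set mu | (forall i, 0 <= mu ord0 i) /\ \sum_(i < M) mu ord0 i = 1].

Definition couplings (R : realType) (M : nat) (mu nu : 'rV[R]_M) :
    set 'M[R]_(M, M) :=
  [set p | [/\ forall i j, 0 <= p i j,
               forall i, \sum_(j < M) p i j = mu ord0 i
             & forall j, \sum_(i < M) p i j = nu ord0 j]].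

Definition mean (R : realType) (d M N : nat) (mu : 'rV[R]_M)
    (p : 'M[R]_(M, N)) (z : 'I_N -> 'rV[R]_d) (i : 'I_M) : 'rV[R]_d :=
  (mu ord0 i)^-1 *: \sum_(j < N) p i j *: z j.

Definition minimizers (R : realType) (T : Type) (A : set T) (f : T -> R) :
    set T :=
  [set a | A a /\ forall b, A b -> f a <= f b].

Definition bwot_cost (R : realType) (d M : nat)
    (c : 'rV[R]_d -> 'rV[R]_d -> R) (x : 'I_M -> 'rV[R]_d) (mu : 'rV[R]_M)
    (p : 'M[R]_(M, M)) : R :=
  \sum_(i < M) mu ord0 i * c (x i) (mean mu p x i).

Definition bwot_optimal (R : realType) (d M : nat)
    (c : 'rV[R]_d -> 'rV[R]_d -> R) (x : 'I_M -> 'rV[R]_d)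
    (mu nu : 'rV[R]_M) : set 'M[R]_(M, M) :=
  minimizers (couplings mu nu) (bwot_cost c x mu).

(* An infimum in R: it is the minimum V(mu, nu) as soon as bwot_optimal is
   nonempty. *)
Definition bwot_value (R : realType) (d M : nat)
    (c : 'rV[R]_d -> 'rV[R]_d -> R) (x : 'I_M -> 'rV[R]_d)
    (mu nu : 'rV[R]_M) : R :=
  inf [set bwot_cost c x mu p | p in couplings mu nu].

Definition relaxed_feasible (R : realType) (d M N : nat)
    (x : 'I_M -> 'rV[R]_d) (y : 'I_N -> 'rV[R]_d) (mu nu : 'rV[R]_M) :
    set ('M[R]_(M, M) * 'M[R]_(M, N)) :=
  [set p : 'M[R]_(M, M) * 'M[R]_(M, N) |
    [/\ (forall i j, 0 <= p.1 i j) /\ (forall i k, 0 <= p.2 i k),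
        (forall i, \sum_(j < M) p.1 i j = mu ord0 i) /\
        (forall i, \sum_(k < N) p.2 i k = mu ord0 i),
        forall j, \sum_(i < M) p.1 i j = nu ord0 j
      & forall i, \sum_(j < M) p.1 i j *: x j = \sum_(k < N) p.2 i k *: y k]].

Definition relaxed_cost (R : realType) (d M N : nat)
    (c : 'rV[R]_d -> 'rV[R]_d -> R) (x : 'I_M -> 'rV[R]_d)
    (y : 'I_N -> 'rV[R]_d) (p : 'M[R]_(M, M) * 'M[R]_(M, N)) : R :=
  \sum_(i < M) \sum_(k < N) p.2 i k * c (x i) (y k).

Definition relaxed_optimal (R : realType) (d M N : nat)
    (c : 'rV[R]_d -> 'rV[R]_d -> R) (x : 'I_M -> 'rV[R]_d)
    (y : 'I_N -> 'rV[R]_d) (mu nu : 'rV[R]_M) :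
    set ('M[R]_(M, M) * 'M[R]_(M, N)) :=
  minimizers (relaxed_feasible x y mu nu) (relaxed_cost c x y).

Lemma relaxed_feasible_mean (R : realType) (d M N : nat)
    (x : 'I_M -> 'rV[R]_d) (y : 'I_N -> 'rV[R]_d) (mu nu : 'rV[R]_M)
    (p : 'M[R]_(M, M) * 'M[R]_(M, N)) (i : 'I_M) :
  relaxed_feasible x y mu nu p -> mean mu p.1 x i = mean mu p.2 y i.
Proof. by case=> _ _ _ xy; rewrite /mean xy. Qed.

(* Main.v *)
(* The relaxed optimal values squeeze onto V(mu, nu).  From below, Jensen's
   inequality bounds the relaxed cost of (pix n, piy n) by the barycentric cost
   of pix n, hence by V(mu, nu).  From above, each optimal mean m_i lies in the
   open set U, so for large n it is a convex combination of points of Y_n that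
   are all close to m_i; since c (x i) is continuous, being convex and finite on
   R^d, these weights give a relaxed competitor of cost at most V(mu, nu) + eps.
   In the strictly convex case, averaging two optimal couplings shows that the
   means are unique, and compactness of the set of couplings gives their
   convergence along the minimizing sequence pix n. *)
Require Import Defs.
From HB Require Import structures.
From mathcomp Require Import all_boot all_order all_algebra.
From mathcomp Require Import all_classical all_reals all_analysis.
From mathcomp Require Import ring lra.
Import Order.TTheory GRing.Theory Num.Theory.
Import numFieldNormedType.Exports.

Set Implicit Arguments.
Unset Strict Implicit.
Unset Printing Implicit Defensive.

Local Open Scope classical_set_scope.
Local Open Scope ring_scope.

(** * Finite convex combinations, Jensen's inequality and continuity of convex functions *)

Section Convexity.
Variable R : realType.

Lemma convex_set_comb2 (V : lmodType R) (A : set (convex_lmodType V))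
    (u v : V) (t : R) :
  convex_set A -> A u -> A v -> 0 <= t -> t <= 1 ->
  A (t *: u + (1 - t) *: v).
Proof.
move=> cA Au Av t0 t1; apply/set_mem.
by apply: (cA u v (Itv01 t0 t1)); apply/mem_set.
Qed.

Lemma convex_set_comb (V : lmodType R) (A : set (convex_lmodType V))
    (N : nat) (l : 'I_N -> R) (z : 'I_N -> V) :
  convex_set A -> (forall k, A (z k)) -> (forall k, 0 <= l k) ->
  \sum_k l k = 1 -> A (\sum_k l k *: z k).
Proof.
move=> cA Az l0 l1.
(* Partial sums have total weight below 1, so the induction tracks them without normalising: a
   partial sum [v] of weight [w] is either zero with zero weight, or [w] times a point of [A]. Total
   weight 1 excludes the first case at the end. *)
pose P (w : R) (v : V) :=
  0 <= w /\ (w = 0 /\ v = 0 \/ exists2 m : V, A m & v = w *: m).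
have [_ [[/eqP]|]] : P (\sum_k l k) (\sum_k l k *: z k).
- apply: (big_rec2 P) => [|k w v _ [w0 H]]; first by split; [|left].
  split; first exact: addr_ge0.
  case: H => [[-> ->]|[m Am ->]].
    by right; exists (z k); rewrite ?addr0.
  have [s0|s0] := eqVneq (l k + w) 0.
    have [-> ->] : l k = 0 /\ w = 0 by have := l0 k; split; lra.
    by left; rewrite !scale0r !addr0.
  have sgt0 : 0 < l k + w by rewrite lt_def s0 addr_ge0.
  right; exists ((l k / (l k + w)) *: z k + (1 - l k / (l k + w)) *: m).
    apply: convex_set_comb2 => //; first by rewrite divr_ge0// ltW.
    by rewrite ler_pdivrMr// mul1r lerDl.
  rewrite scalerDr !scalerA mulrBr mulr1 mulrCA divff// mulr1.
  by rewrite addrAC subrr add0r.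
- by rewrite l1 oner_eq0.
- by case=> m Am; rewrite l1 scale1r => ->.
Qed.

Section ConvexFunction.
Variables (d : nat) (f : 'rV[R]_d -> R).
Hypothesis cf : convex_function [set: convex_lmodType 'rV[R]_d] f.

Lemma convex_function_comb2 (u v : 'rV[R]_d) (t : R) : 0 <= t -> t <= 1 ->
  f (t *: u + (1 - t) *: v) <= t * f u + (1 - t) * f v.
Proof. by move=> t0 t1; apply: (cf (Itv01 t0 t1)); rewrite inE. Qed.

(** The epigraph of [f] is a convex subset of the product with the real line, so it contains the
    convex combination of the points [(z k, f (z k))]. *)
Lemma jensen (N : nat) (l : 'I_N -> R) (z : 'I_N -> 'rV[R]_d) :
  (forall k, 0 <= l k) -> \sum_k l k = 1 ->
  f (\sum_k l k *: z k) <= \sum_k l k * f (z k).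
Proof.
move=> l0 l1.
pose epi : set ('rV[R]_d * R^o)%type := [set p | f p.1 <= p.2].
have cepi : @convex_set R ('rV[R]_d * R^o)%type epi.
  move=> u v t /set_mem fu /set_mem fv; apply/mem_set.
  rewrite /epi /= in fu fv *.
  apply: le_trans (convex_function_comb2 u.1 v.1 _ _) _ => //.
  by rewrite lerD// ler_wpM2l// subr_ge0.
have := convex_set_comb (z := fun k => (z k, f (z k))) cepi
  (fun k => lexx (f (z k))) l0 l1.
by rewrite /epi /= !raddf_sum.
Qed.

(** Jensen's inequality for weights of total at most 1: the missing mass is placed at [z] itself. In
    this form it bounds the increment of [f] at [z] by increments along finitely many directions. *)
Lemma jensen_sub (N : nat) (l : 'I_N -> R) (z : 'rV[R]_d)
    (w : 'I_N -> 'rV[R]_d) :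
  (forall k, 0 <= l k) -> \sum_k l k <= 1 ->
  f (z + \sum_k l k *: w k) <= f z + \sum_k l k * (f (z + w k) - f z).
Proof.
move=> l0 l1.
(* Index 0 carries the slack and the base point; the other indices carry the given weights and the
   points [z + w j]. *)
pose l' (k : 'I_N.+1) :=
  if unlift ord0 k is Some j then l j else 1 - \sum_k l k.
pose z' (k : 'I_N.+1) := if unlift ord0 k is Some j then z + w j else z.
have l'0 k : 0 <= l' k by rewrite /l'; case: unliftP => //; rewrite subr_ge0.
have l'1 : \sum_k l' k = 1.
  rewrite big_ord_recl /l' unlift_none.
  by under [X in _ + X]eq_bigr do rewrite liftK; rewrite subrK.
have -> : z + \sum_k l k *: w k = \sum_k l' k *: z' k.
  rewrite big_ord_recl /l' /z' unlift_none.
  under [X in _ = _ + X]eq_bigr do rewrite liftK scalerDr.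
  by rewrite big_split /= -scaler_suml addrA -scalerDl subrK scale1r.
apply: le_trans (jensen z' l'0 l'1) _.
rewrite big_ord_recl /l' /z' unlift_none.
under [X in _ + X <= _]eq_bigr do rewrite liftK.
under [X in _ <= _ + X]eq_bigr do rewrite mulrBr.
rewrite big_split /= sumrN -mulr_suml mulrBl mul1r.
by rewrite -addrA lerD2l addrC.
Qed.

(** Near [z] there is a bound of the form [B * |h|] on the increment. From above, a small [h] is a
    combination of signed basis vectors with weights [|h_k|] of total at most 1, so the [2 d]
    increments collected in [B] suffice. From below, [z] is the midpoint of [z + h] and [z - h],
    which turns the upper bound at [- h] into a lower bound at [h]. *)
Lemma convex_function_continuous : continuous f.
Proof.
move=> z.
pose e (k : 'I_d) : 'rV[R]_d := delta_mx ord0 k.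
pose B := \sum_(k < d) (`|f (z + e k) - f z| + `|f (z - e k) - f z|).
have B0 : 0 <= B by apply: sumr_ge0 => k _; rewrite addr_ge0.
have ub h : d%:R * `|h| <= 1 -> f (z + h) - f z <= B * `|h|.
  move=> h1.
  have hk k : `|h ord0 k| <= `|h|.
    rewrite [leRHS]/Num.norm /= mx_normrE.
    exact: (le_bigmax _ (fun ij : 'I_1 * 'I_d => `|h ij.1 ij.2|) (ord0, k)).
  have hE : h = \sum_k `|h ord0 k| *: (Num.sg (h ord0 k) *: e k).
    rewrite {1}[h]row_sum_delta; apply: eq_bigr => k _.
    by rewrite scalerA [_ * Num.sg _]mulrC -numEsg.
  rewrite lerBlDl [h in f (_ + h)]hE (le_trans (jensen_sub _ _ _ _))//.
    apply: le_trans h1; apply: le_trans (ler_sum _ (fun k _ => hk k)) _.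
    by rewrite sumr_const card_ord mulr_natl.
  rewrite lerD2l /B mulr_suml; apply: ler_sum => k _.
  have sB : f (z + Num.sg (h ord0 k) *: e k) - f z <=
      `|f (z + e k) - f z| + `|f (z - e k) - f z|.
    case: sgrP => _; rewrite ?scale0r ?scale1r ?scaleN1r.
    - by rewrite addr0 subrr addr_ge0.
    - by rewrite (le_trans (ler_norm _))// lerDl.
    - by rewrite (le_trans (ler_norm _))// lerDr.
  rewrite (le_trans (ler_wpM2l _ sB))// mulrC ler_wpM2l ?addr_ge0//.
have bd h : d%:R * `|h| <= 1 -> `|f (z + h) - f z| <= B * `|h|.
  move=> h1; rewrite ler_norml ub// andbT.
  have := ub (- h); rewrite normrN => /(_ h1) ubN.
  have : f z <= 2^-1 * f (z + h) + (1 - 2^-1) * f (z - h).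
    rewrite -[X in f X <= _](_ : 2^-1 *: (z + h) + (1 - 2^-1) *: (z - h) = z).
      by apply: convex_function_comb2; lra.
    by apply/rowP => k; rewrite !mxE; lra.
  by move: ubN; lra.
apply/(@cvgrPdist_le _ _ _ (nbhs z)) => /= eps eps0.
have d1 : 0 < d%:R + 1 :> R by rewrite ltr_wpDl.
have B1 : 0 < B + 1 by rewrite ltr_wpDl.
(* The first radius puts [h] in the range where the bound holds, the second makes [B * |h|] at most
   [eps]. Adding 1 keeps both denominators positive when [d] or [B] is zero. *)
apply/nbhs_ballP; exists (Num.min (d%:R + 1)^-1 (eps / (B + 1))) => /=.
  by rewrite lt_min invr_gt0 d1 divr_gt0.
move=> t; rewrite -ball_normE /= -normrN opprB lt_min => /andP[td te].
have tle (a r : R) : 0 <= a -> `|t - z| < r / (a + 1) -> a * `|t - z| <= r.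
  move=> a0; rewrite ltr_pdivlMr ?ltr_wpDl// => /ltW; apply: le_trans.
  by rewrite mulrDr mulr1 mulrC lerDl.
rewrite distrC -[in f t](subrKC z t) (le_trans (bd _ _)) ?tle//.
by rewrite mul1r.
Qed.

End ConvexFunction.
End Convexity.

(** * Compactness of the set of couplings and existence of minimizers *)

Section Compactness.
Variable R : realType.

Lemma continuous_mx (T : topologicalType) (m n : nat)
    (f : T -> 'M[R]_(m, n)) :
  (forall i j, continuous (fun t => f t i j)) -> continuous f.
Proof.
move=> cf x A [P nP sPA]; apply: filterS (fun t Pt => sPA (f t) Pt) _.
by apply: filter_forall => i; apply: filter_forall => j; apply/cf/nP.
Qed.

Lemma continuous_sum (T : topologicalType) (V : normedModType R) (N : nat)
    (F : 'I_N -> T -> V) :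
  (forall k, continuous (F k)) -> continuous (fun t => \sum_k F k t).
Proof. by move=> cF; apply: continuous_big => //; exact: add_continuous. Qed.

(** A box of matrices is the continuous image, under [vec_mx], of a product of segments in a space
    of row vectors. *)
Lemma mx_box_compact (m n : nat) (u : 'M[R]_(m, n)) :
  compact [set p : 'M[R]_(m, n) | forall i j, 0 <= p i j <= u i j].
Proof.
pose B := [set v : 'rV[R]_(m * n) |
  forall k, [set` `[0, mxvec u ord0 k]] (v ord0 k)].
have -> : [set p : 'M[R]_(m, n) | forall i j, 0 <= p i j <= u i j] =
    vec_mx @` B.
  apply/seteqP; split=> [p pu|_ [v vB <-] i j].
    exists (mxvec p); last exact: mxvecK.
    by move=> k; case/mxvec_indexP: k => i j; rewrite /= in_itv /= !mxvecE.
  by have := vB (mxvec_index i j); rewrite /= in_itv /= mxvecE mxE.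
apply: continuous_compact.
  apply/continuous_subspaceT/continuous_mx => i j v.
  under eq_fun do rewrite mxE.
  exact: coord_continuous.
apply: (@rV_compact R _ (fun k => [set` `[0, mxvec u ord0 k]])) => k.
exact: segment_compact.
Qed.

Lemma row_sum_closed (m n : nat) (r : 'I_m -> R) :
  closed [set p : 'M[R]_(m, n) | forall i, \sum_j p i j = r i].
Proof.
rewrite (_ : mkset _ = \bigcap_(i in setT)
  ((fun p : 'M[R]_(m, n) => \sum_j p i j) @^-1` [set r i])); last first.
  by apply/seteqP; split=> [p pr i _|p pr i]; apply: pr.
apply: closed_bigI => i _; apply: preimage_closed; last exact: closed_eq.
move=> p _; apply: (@continuous_sum 'M[R]_(m, n) R^o) => j.
exact: coord_continuous.
Qed.

Lemma col_sum_closed (m n : nat) (r : 'I_n -> R) :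
  closed [set p : 'M[R]_(m, n) | forall j, \sum_i p i j = r j].
Proof.
rewrite (_ : mkset _ = \bigcap_(j in setT)
  ((fun p : 'M[R]_(m, n) => \sum_i p i j) @^-1` [set r j])); last first.
  by apply/seteqP; split=> [p pr i _|p pr i]; apply: pr.
apply: closed_bigI => i _; apply: preimage_closed; last exact: closed_eq.
move=> p _; apply: (@continuous_sum 'M[R]_(m, n) R^o) => j.
exact: coord_continuous.
Qed.

(** Nonnegative entries are bounded by their row sums, so the couplings form the intersection of a
    compact box with the closed marginal constraints. *)
Lemma couplings_compact (M : nat) (mu nu : 'rV[R]_M) :
  compact (couplings mu nu).
Proof.
rewrite (_ : couplings mu nu =
  [set p | forall i j, 0 <= p i j <= (\matrix_(i, j) mu ord0 i) i j] `&`
  [set p | forall i, \sum_j p i j = mu ord0 i] `&`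
  [set p | forall j, \sum_i p i j = nu ord0 j]).
  apply: compact_closedI; last exact: col_sum_closed.
  by apply: compact_closedI; [exact: mx_box_compact|exact: row_sum_closed].
apply/seteqP; split=> [p [p0 pr pc]|p [[pb pr] pc]]; do ![split] => //.
  move=> i j; rewrite p0 mxE -pr (bigD1 j)//= lerDl.
  by apply: sumr_ge0 => k _; exact: p0.
by move=> i j; case/andP: (pb i j).
Qed.

Lemma couplings_nonempty (M : nat) (mu nu : 'rV[R]_M) :
  simplex mu -> simplex nu -> couplings mu nu !=set0.
Proof.
move=> [mu0 mu1] [nu0 nu1].
(* The product coupling. *)
exists (\matrix_(i, j) (mu ord0 i * nu ord0 j)); split=> [i j|i|j].
- by rewrite mxE mulr_ge0.
- by under eq_bigr do rewrite mxE; rewrite -mulr_sumr nu1 mulr1.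
- by under eq_bigr do rewrite mxE; rewrite -mulr_suml mu1 mul1r.
Qed.

Lemma compact_continuous_min (T : topologicalType) (f : T -> R) (A : set T) :
  A !=set0 -> compact A -> continuous f -> exists a, minimizers A f a.
Proof.
move=> A0 cA cf.
have [a /set_mem Aa amin] :=
  compact_EVT_min A0 cA (continuous_subspaceT cf).
by exists a; split=> // b /mem_set/amin.
Qed.

End Compactness.

(** * Representing a point as a convex combination of nearby net points *)

Section LocalNet.
Variable R : realType.

(* If a point of the hull of the nearby [y k] closest to [z] were at [z + w]
   with [w != 0], mixing in a [y k] close to [z - (rad / `|w|) *: w] would bring
   it closer to [z]. *)
Lemma net_convex_comb (V : normedModType R) (N : nat) (y : 'I_N -> V) (z : V)
    (rad eta : R) :
  0 <= eta -> eta < rad ->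
  (forall b, `|b - z| <= rad -> exists k, `|y k - b| <= eta) ->
  exists l : 'I_N -> R, [/\ forall k, 0 <= l k, \sum_k l k = 1,
    \sum_k l k *: y k = z & forall k, l k != 0 -> `|y k - z| <= 2 * rad].
Proof.
move=> eta0 etar net.
have rad0 : 0 < rad by exact: le_lt_trans etar.
(* Locality is encoded in the box: the upper bound 0 removes all weight from points farther than
   [2 * rad] from [z]. The residual [s p] is then minimised in norm over the compact set [A] of
   admissible weights. *)
pose u : 'rV[R]_N := \row_k (if `|y k - z| <= 2 * rad then 1 else 0).
pose A := [set p : 'rV[R]_N | forall i j, 0 <= p i j <= u i j] `&`
  [set p | forall i, \sum_j p i j = 1].
pose s (p : 'rV[R]_N) := \sum_k p ord0 k *: y k - z.
have cA : compact A.
  by apply: compact_closedI; [exact: mx_box_compact|exact: row_sum_closed].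
have cs : continuous (fun p => `|s p|).
  move=> p; apply: continuous_comp; last exact: norm_continuous.
  apply: continuousB; last exact: cst_continuous.
  apply: continuous_sum => k q.
  apply: (@continuous_comp _ _ _ (fun p : 'rV[R]_N => p ord0 k)
    (fun a : R => a *: y k)); first exact: coord_continuous.
  exact: scalel_continuous.
have A_delta k : `|y k - z| <= 2 * rad -> A (delta_mx ord0 k).
  move=> ky; split=> [i j|i].
    rewrite !mxE; have [->|_] := eqVneq j k; last first.
      by case: ifP; rewrite andbF lexx /=.
    by rewrite ky ord1 eqxx /= ler01 lexx.
  rewrite (bigD1 k)//= big1 ?addr0 => [|j jk]; rewrite mxE ord1 eqxx ?eqxx//.
  by rewrite (negbTE jk).
have A0 : A !=set0.
  have [|k yk] := net z; first by rewrite subrr normr0 ltW.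
  by exists (delta_mx ord0 k); apply: A_delta; lra.
have [p [Ap pmin]] := compact_continuous_min A0 cA cs.
have [w0|w0] := eqVneq (s p) 0.
  exists (p ord0); case: Ap => pb pr; split=> [k|||k].
  - by case/andP: (pb ord0 k).
  - exact: pr.
  - by apply/eqP; rewrite -subr_eq0 -/(s p) w0.
  - apply: contraNT => yk; have := pb ord0 k.
    by rewrite mxE (negbTE yk) -eq_le eq_sym.
pose w := s p; have wgt0 : 0 < `|w| by rewrite normr_gt0.
have wn0 : `|w| != 0 by rewrite gt_eqF.
have c0 : 0 <= rad / `|w| by rewrite divr_ge0// ltW.
have [|k yk] := net (z - (rad / `|w|) *: w).
  by rewrite addrC addKr normrN normrZ ger0_norm// divfK.
have kz : `|y k - z| <= 2 * rad.
  have -> : y k - z = (y k - (z - (rad / `|w|) *: w)) - (rad / `|w|) *: w.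
    by rewrite opprB addrA addrAC addrK.
  rewrite (le_trans (ler_normB _ _))// normrZ ger0_norm//.
  by rewrite divfK// mulr_natl mulr2n lerD// (le_trans yk) ?ltW.
(* This [t] solves [1 - t = t * (rad / |w|)], so the multiples of [w] cancel and the new residual is
   [t] times the error of the net at the chosen point. Its norm is at most [t * eta], which is below
   [|w|] because [eta < rad]. *)
pose t := `|w| / (`|w| + rad).
have wr0 : 0 < `|w| + rad by rewrite addr_gt0.
have t0 : 0 < t by rewrite divr_gt0.
have t1 : t <= 1 by rewrite ler_pdivrMr// mul1r lerDl ltW.
pose q : 'rV[R]_N := (1 - t) *: p + t *: delta_mx ord0 k.
have Aq : A q.
  have [db dr] := A_delta k kz; case: Ap => pb pr; split=> [i j|i].
    have /andP[p0 p1] := pb i j; have /andP[d0 d1] := db i j.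
    rewrite (_ : q i j = (1 - t) * p i j + t * delta_mx ord0 k i j).
      move: (p i j) (u i j) (delta_mx _ _ i j) p0 p1 d0 d1 => a b c *.
      by apply/andP; split; nra.
    by rewrite !mxE.
  under eq_bigr do rewrite !mxE.
  rewrite big_split /= -!mulr_sumr pr mulr1.
  have := dr i; under eq_bigr do rewrite mxE; move=> ->.
  by rewrite mulr1 subrK.
have sq : s q = t *: (y k - (z - (rad / `|w|) *: w)).
  have -> : s q = (1 - t) *: w + t *: (y k - z).
    rewrite /w /s.
    have dk : \sum_j (delta_mx ord0 k : 'rV[R]_N) ord0 j *: y j = y k.
      rewrite (bigD1 k)//= big1 => [|j jk]; rewrite mxE ?eqxx.
        by rewrite scale1r addr0.
      by rewrite (negbTE jk) scale0r.
    have qE j : q ord0 j *: y j = (1 - t) *: (p ord0 j *: y j) +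
        t *: ((delta_mx ord0 k : 'rV[R]_N) ord0 j *: y j).
      by rewrite !scalerA -scalerDl !mxE.
    under eq_bigr do rewrite qE.
    rewrite big_split /= -!scaler_sumr dk !scalerBr addrACA -opprD -scalerDl.
    by rewrite subrK scale1r.
  have tE : 1 - t = t * (rad / `|w|).
    by rewrite /t; field; rewrite wn0 gt_eqF.
  by rewrite opprB addrCA [RHS]scalerDr scalerA -tE.
have := pmin q Aq; rewrite leNgt => /negP; case.
rewrite -/w sq normrZ gtr0_norm//.
apply: (le_lt_trans (ler_wpM2l (ltW t0) yk)).
rewrite /t mulrAC ltr_pdivrMr// ltr_pM2l//; lra.
Qed.

(** Passes from the Euclidean norm in [excess_dist] to the sup norm in which balls and limits are
    expressed. *)
Lemma eucl_norm_ge (d : nat) (v : 'rV[R]_d) : `|v| <= eucl_norm v.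
Proof.
rewrite [leLHS]/Num.norm /= mx_normrE; apply: bigmax_le.
  exact: sqrtr_ge0.
move=> [i j] _ /=; rewrite ord1 -sqrtr_sqr; apply: ler_wsqrtr.
rewrite (bigD1 j)//= lerDl; apply: sumr_ge0 => k _; exact: sqr_ge0.
Qed.

Lemma excess_dist_net (d N : nat) (U : set 'rV[R]_d) (y : 'I_N -> 'rV[R]_d)
    (eta : R) (b : 'rV[R]_d) :
  (excess_dist U (range y) < eta%:E)%E -> U b -> exists k, `|y k - b| <= eta.
Proof.
move=> Ueta Ub.
have : (ereal_inf [set (eucl_norm (b - a))%:E | a in range y] < eta%:E)%E.
  by apply: le_lt_trans Ueta; apply: ereal_sup_ubound; exists b.
move=> /ereal_inf_lt[_ [_ [k _ <-] <-]]; rewrite lte_fin => yb.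
by exists k; rewrite distrC (le_trans (eucl_norm_ge _))// ltW.
Qed.

Lemma net_weights_near (d : nat) (U : set 'rV[R]_d) (N : nat -> nat)
    (y : forall n, 'I_(N n) -> 'rV[R]_d) (f : 'rV[R]_d -> R) (z : 'rV[R]_d)
    (eps : R) :
  open U -> excess_dist U (range (y n)) @[n --> \oo] --> 0%E ->
  continuous f -> U z -> 0 < eps ->
  \forall n \near \oo, exists l : 'I_(N n) -> R,
    [/\ forall k, 0 <= l k, \sum_k l k = 1, \sum_k l k *: y n k = z
      & \sum_k l k * f (y n k) <= f z + eps].
Proof.
move=> oU yU cf Uz eps0.
have : \forall v \near z, U v /\ f v <= f z + eps.
  apply: filterI; first exact: open_nbhs_nbhs.
  by apply: (cvgr_le (f z) (cf z)); rewrite ltrDl.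
move=> /nbhs_ballP[r /= r0]; rewrite -ball_normE => rU.
have e0 : (0 < (r / 8)%:E)%E by rewrite lte_fin; lra.
have : \forall n \near \oo, (excess_dist U (range (y n)) < (r / 8)%:E)%E.
  exact: (yU [set e | (e < (r / 8)%:E)%E] (open_ereal_lt' e0)).
apply: filterS => n Un.
(* The ball of radius [r] around [z] lies in [U], and [f <= f z + eps] holds on it. Points within
   [r / 4] of [z] are thus in [U], where the net has precision [r / 8], and the weights charge only
   points within [r / 2], still inside the ball. *)
have [||b bz|l [l0 l1 lz lnear]] :=
  @net_convex_comb _ _ (y n) z (r / 4) (r / 8); [lra|lra| |].
  apply: excess_dist_net Un _.
  by apply: (rU b _).1; rewrite /= distrC; lra.
exists l; split=> //.
rewrite -[leRHS]mul1r -l1 mulr_suml; apply: ler_sum => k _.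
have [->|lk] := eqVneq (l k) 0; first by rewrite !mul0r.
rewrite ler_wpM2l//; apply: (rU (y n k) _).2.
by have := lnear k lk; rewrite /= distrC; lra.
Qed.

Lemma mean_convex_hull (d M N : nat) (mu : 'rV[R]_M) (p : 'M[R]_(M, N))
    (z : 'I_N -> 'rV[R]_d) (i : 'I_M) :
  0 < mu ord0 i -> (forall j, 0 <= p i j) -> \sum_j p i j = mu ord0 i ->
  convex_hull (range z) (mean mu p z i).
Proof.
move=> mu0 p0 pr B [cB zB].
rewrite /mean scaler_sumr; under eq_bigr do rewrite scalerA.
apply: convex_set_comb => // [k|k|].
- by apply: zB; exists k.
- by rewrite mulr_ge0// invr_ge0 ltW.
- by rewrite -mulr_sumr pr mulVf// gt_eqF.
Qed.

End LocalNet.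

(** * The barycentric cost, its minimizers and its comparison with the relaxed cost *)

Section Transport.
Variables (R : realType) (d M : nat).
Variables (c : 'rV[R]_d -> 'rV[R]_d -> R) (x : 'I_M -> 'rV[R]_d).
Variables (mu nu : 'rV[R]_M).
Hypothesis mu_gt0 : forall i, 0 < mu ord0 i.
Hypothesis cc : forall a : 'rV[R]_d,
  convex_function [set: convex_lmodType 'rV[R]_d] (c a).

Lemma mean_continuous (N : nat) (z : 'I_N -> 'rV[R]_d) (i : 'I_M) :
  continuous (fun p : 'M[R]_(M, N) => mean mu p z i).
Proof.
move=> p; apply: continuous_comp; last exact: scaler_continuous.
apply: continuous_sum => k q.
apply: (@continuous_comp _ _ _ (fun p : 'M[R]_(M, N) => p i k)
  (fun a : R => a *: z k)); first exact: coord_continuous.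
exact: scalel_continuous.
Qed.

Lemma bwot_cost_continuous : continuous (bwot_cost c x mu).
Proof.
apply: (@continuous_sum R _ R^o) => i p.
apply: continuousM; first exact: cst_continuous.
apply: continuous_comp; first exact: mean_continuous.
exact: convex_function_continuous.
Qed.

Lemma bwot_optimal_exists :
  simplex mu -> simplex nu -> exists p, bwot_optimal c x mu nu p.
Proof.
move=> smu snu; apply: compact_continuous_min.
- exact: couplings_nonempty.
- exact: couplings_compact.
- exact: bwot_cost_continuous.
Qed.

Lemma bwot_valueE p : bwot_optimal c x mu nu p ->
  bwot_value c x mu nu = bwot_cost c x mu p.
Proof.
move=> [pc pmin]; apply/eqP; rewrite eq_le; apply/andP; split.
  by apply: ge_inf; [exists (bwot_cost c x mu p) => _ [q qc <-]; exact: pmin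
                    |exists p].
by apply: lb_le_inf; [exists (bwot_cost c x mu p), p
                     |move=> _ [q qc <-]; exact: pmin].
Qed.

(** Row [i] of [p.2] divided by [mu_i] is a probability vector on the points [y k] whose barycentre
    is also the mean of row [i] of [p.1], so Jensen applies row by row. *)
Lemma bwot_cost_le_relaxed (N : nat) (y : 'I_N -> 'rV[R]_d) p :
  relaxed_feasible x y mu nu p -> bwot_cost c x mu p.1 <= relaxed_cost c x y p.
Proof.
move=> pf; apply: ler_sum => i _; rewrite (relaxed_feasible_mean i pf).
case: pf => [[_ p0] [_ pr] _ _].
rewrite -ler_pdivlMl ?mu_gt0// mulr_sumr /mean scaler_sumr.
under eq_bigr do rewrite scalerA.
under [leRHS]eq_bigr do rewrite mulrA.
apply: (jensen (cc (x i))) => [k|].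
  by rewrite mulr_ge0// invr_ge0 ltW.
by rewrite -mulr_sumr pr mulVf// gt_eqF.
Qed.

(** The coupling [p] is kept and only the second component is built: row [i] spreads the mass [mu_i]
    over points of the net near the mean, with weights that reproduce the mean exactly, as the last
    feasibility constraint demands. *)
Lemma relaxed_cost_near_bwot (U : set 'rV[R]_d) (N : nat -> nat)
    (y : forall n, 'I_(N n) -> 'rV[R]_d) (p : 'M[R]_(M, M)) (eps : R) :
  simplex mu -> open U -> convex_hull (range x) `<=` U ->
  excess_dist U (range (y n)) @[n --> \oo] --> 0%E ->
  couplings mu nu p -> 0 < eps ->
  \forall n \near \oo, exists q, relaxed_feasible x (y n) mu nu (p, q) /\
    relaxed_cost c x (y n) (p, q) <= bwot_cost c x mu p + eps.
Proof.
move=> smu oU xU yU [p0 pr pc] eps0.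
have : \forall n \near \oo, forall i, exists l : 'I_(N n) -> R,
    [/\ forall k, 0 <= l k, \sum_k l k = 1, \sum_k l k *: y n k = mean mu p x i
      & \sum_k l k * c (x i) (y n k) <= c (x i) (mean mu p x i) + eps].
  apply: filter_forall => i; apply: net_weights_near oU yU _ _ eps0.
    exact: convex_function_continuous.
  by apply: xU; exact: mean_convex_hull.
apply: filterS => n /choice[l ln].
exists (\matrix_(i, k) (mu ord0 i * l i k)); split.
  split=> [|||i] /=.
  - split=> // i k; rewrite mxE mulr_ge0 ?(ltW (mu_gt0 i))//; by case: (ln i).
  - split=> // i; under eq_bigr do rewrite mxE.
    by rewrite -mulr_sumr; case: (ln i) => _ -> _ _; rewrite mulr1.
  - exact: pc.
  - under [RHS]eq_bigr do rewrite mxE -scalerA.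
    rewrite -scaler_sumr; case: (ln i) => _ _ -> _.
    by rewrite /mean scalerA divff ?scale1r ?gt_eqF.
(* Since [mu] has total mass 1, an error [eps] in each row costs [eps] overall. *)
have -> : eps = \sum_i mu ord0 i * eps by rewrite -mulr_suml smu.2 mul1r.
rewrite -big_split /=; apply: ler_sum => i _.
rewrite -mulrDr; under eq_bigr do rewrite mxE -mulrA.
by rewrite -mulr_sumr ler_pM2l//; case: (ln i).
Qed.

Lemma bwot_optimal_mean_unique p q :
  (forall a : 'rV[R]_d, strictly_convex_function (c a)) ->
  bwot_optimal c x mu nu p -> bwot_optimal c x mu nu q ->
  forall i, mean mu p x i = mean mu q x i.
Proof.
move=> sc [[p0 pr pc] pmin] [[q0 qr qc] qmin] i.
apply/eqP; apply: contraT => ne.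
pose h : R := 2^-1; have h0 : 0 < h by rewrite /h; lra.
have h1 : h < 1 by rewrite /h; lra.
pose r := h *: p + (1 - h) *: q.
have avgE (s t : R) : s = t -> h * s + (1 - h) * t = s.
  by move=> ->; rewrite -mulrDl subrKC mul1r.
have rC : couplings mu nu r.
  split=> [a b|a|b].
  - by rewrite /r !mxE addr_ge0// mulr_ge0// ?subr_ge0 ltW.
  - under eq_bigr do rewrite !mxE.
    by rewrite big_split /= -!mulr_sumr pr qr avgE.
  - under eq_bigr do rewrite !mxE.
    by rewrite big_split /= -!mulr_sumr pc qc avgE.
have rm j : mean mu r x j = h *: mean mu p x j + (1 - h) *: mean mu q x j.
  rewrite /mean /r; under eq_bigr do rewrite !mxE scalerDl -!scalerA.
  rewrite big_split /= -!scaler_sumr scalerDr.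
  by rewrite !(scalerA (mu _ _)^-1) !(mulrC (mu _ _)^-1) -!scalerA.
have : bwot_cost c x mu r < bwot_cost c x mu p.
  (* The two optimal costs agree, so the right side is their average. Comparing termwise, row [i]
     gives a strict inequality because its means differ; the remaining rows use plain convexity. *)
  rewrite -(avgE (bwot_cost c x mu p) (bwot_cost c x mu q)); last first.
    by apply/eqP; rewrite eq_le pmin// qmin.
  rewrite /bwot_cost !mulr_sumr -big_split /=.
  rewrite (bigD1 i)//= [ltRHS](bigD1 i)//=; apply: ltr_leD.
    rewrite rm !(mulrCA _ (mu ord0 i)) -mulrDr ltr_pM2l//.
    exact: sc.
  apply: ler_sum => j _; rewrite rm !(mulrCA _ (mu ord0 j)) -mulrDr ler_pM2l//.
  by apply: convex_function_comb2 => //; rewrite ltW.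
by rewrite ltNge pmin.
Qed.

End Transport.

(** * Convergence along minimizing sequences, and the limits of values and means *)

Lemma minimizing_sequence_cvg (R : realType) (T : topologicalType)
    (V : normedModType R) (K : set T) (F : T -> R) (G : T -> V) (a : T)
    (m : V) (p : nat -> T) :
  compact K -> continuous F -> continuous G -> minimizers K F a ->
  (forall b, minimizers K F b -> G b = m) ->
  (forall n, K (p n)) -> F (p n) @[n --> \oo] --> F a ->
  G (p n) @[n --> \oo] --> m.
Proof.
move=> cK cF cG [Ka amin] Gm Kp Fp.
apply/cvgrPdist_lt => eps eps0.
(* [C] is the part of [K] where [G] stays at least [eps] away from [m]. If nonempty, it is compact
   and [F] attains a minimum there; this minimum exceeds [F a], since otherwise its minimizer would
   minimise [F] over all of [K] and [G] would equal [m] at it. Hence [p n] eventually leaves [C]. *)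
pose C := K `&` [set b | eps <= `|m - G b|].
have cC : compact C.
  apply: compact_closedI => //.
  apply: (@preimage_closed _ _ (fun b => `|m - G b|) [set s | eps <= s]).
    move=> b _; apply: (@continuous_comp _ _ _ (fun b => m - G b)
      (fun v : V => `|v|)); last exact: norm_continuous.
    by apply: continuousB; [exact: cst_continuous|exact: cG].
  exact: closed_ge.
have [C0|/nonemptyPn C0] := pselect (C !=set0); last first.
  apply: nearW => n; rewrite ltNge; apply/negP => np.
  by have : C (p n) by []; rewrite C0.
have [b [[Kb epsb] bmin]] := compact_continuous_min C0 cC cF.
have ab : F a < F b.
  rewrite ltNge; apply/negP => ba.
  have : G b = m by apply: Gm; split=> // e /amin; exact: le_trans.
  by move=> Gb; move: epsb; rewrite /= Gb subrr normr0 leNgt eps0.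
apply: filterS (cvgr_lt (F a) Fp _ ab) => n Fn.
rewrite ltNge; apply/negP => np.
by have := bmin (p n) (conj (Kp n) np); rewrite leNgt Fn.
Qed.

Theorem proposition4p1 (R : realType) (d M : nat) (x : 'I_M -> 'rV[R]_d)
    (mu nu : 'rV[R]_M) (c : 'rV[R]_d -> 'rV[R]_d -> R) (U : set 'rV[R]_d)
    (N : nat -> nat) (y : forall n : nat, 'I_(N n) -> 'rV[R]_d)
    (pix : nat -> 'M[R]_(M, M)) (piy : forall n : nat, 'M[R]_(M, N n))
    (hmu : simplex mu) (hnu : simplex nu)
    (hmu_gt0 : forall i, 0 < mu ord0 i)
    (hc : forall a : 'rV[R]_d,
        convex_function [set: convex_lmodType 'rV[R]_d] (c a))
    (hUo : open U) (hXU : convex_hull (range x) `<=` U)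
    (hUY : forall n, U `<=` convex_hull (range (y n)))
    (hdist : excess_dist U (range (y n)) @[n --> \oo] --> 0%E)
    (hopt : forall n, relaxed_optimal c x (y n) mu nu (pix n, piy n)) :
  [/\ exists p, bwot_optimal c x mu nu p,
      (\sum_(i < M) mu ord0 i * c (x i) (mean mu (pix n) x i)) @[n --> \oo]
        --> bwot_value c x mu nu,
      (\sum_(i < M) \sum_(k < N n) piy n i k * c (x i) (y n k)) @[n --> \oo]
        --> bwot_value c x mu nu
    & (forall a : 'rV[R]_d, strictly_convex_function (c a)) ->
      exists m : 'I_M -> 'rV[R]_d,
        (forall p, bwot_optimal c x mu nu p -> forall i, mean mu p x i = m i) /\
        (forall i, mean mu (pix n) x i @[n --> \oo] --> m i)].
Proof.
have [p pO] := bwot_optimal_exists x hc hmu hnu.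
have feas n : relaxed_feasible x (y n) mu nu (pix n, piy n) by case: (hopt n).
have pixC n : couplings mu nu (pix n).
  by case: (feas n) => [[? _] [? _] ? _]; split.
(* [lo], [mid] and [up] form the chain of inequalities that traps both costs between the optimal
   value and that value plus [eps]. *)
have lo n : bwot_value c x mu nu <= bwot_cost c x mu (pix n).
  by rewrite (bwot_valueE pO); apply: pO.2.
have mid n : bwot_cost c x mu (pix n) <=
    relaxed_cost c x (y n) (pix n, piy n).
  exact: (bwot_cost_le_relaxed hmu_gt0 hc (feas n)).
have up eps : 0 < eps -> \forall n \near \oo,
    relaxed_cost c x (y n) (pix n, piy n) <= bwot_value c x mu nu + eps.
  (* The competitor for [(pix n, piy n)] has the optimal coupling [p] as its first component. *)
  move=> eps0; have := relaxed_cost_near_bwot hmu_gt0 hc hmu hUo hXU hdist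
    pO.1 eps0.
  apply: filterS => n [q [qf qle]]; rewrite (bwot_valueE pO).
  by apply: le_trans qle; apply: (hopt n).2.
have cvx : bwot_cost c x mu (pix n) @[n --> \oo] --> bwot_value c x mu nu.
  apply/cvgrPdist_le => eps eps0; apply: filterS (up eps eps0) => n upn.
  rewrite distrC ger0_norm ?subr_ge0// lerBlDl.
  exact: le_trans (mid n) upn.
have cvy : relaxed_cost c x (y n) (pix n, piy n) @[n --> \oo] -->
    bwot_value c x mu nu.
  apply/cvgrPdist_le => eps eps0; apply: filterS (up eps eps0) => n upn.
  rewrite distrC ger0_norm ?lerBlDl// subr_ge0.
  exact: le_trans (lo n) (mid n).
split=> //; first by exists p.
move=> sc; exists (mean mu p x); split=> [q qO i|i].
  exact: (bwot_optimal_mean_unique hmu_gt0 hc sc qO pO).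
apply: (@minimizing_sequence_cvg _ _ _ (couplings mu nu) (bwot_cost c x mu)
  (fun q => mean mu q x i) p).
- exact: couplings_compact.
- exact: bwot_cost_continuous.
- exact: mean_continuous.
- exact: pO.
- by move=> q qO; exact: (bwot_optimal_mean_unique hmu_gt0 hc sc qO pO).
- exact: pixC.
- by rewrite -(bwot_valueE pO).
Qed.
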